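(* For any integer $n \geq 2$ and any real number $r \ge 0$, \[ \kappa_S(n, r) \geq \begin{cases} \dfrac{2\, B\left( \frac{n-1}{2}, \frac{1}{2} \right)}{B\left(\sec^2 r - \frac{\sec^4 r}{4}; \frac{n-1}{2}, \frac{1}{2} \right)}, & \text{if } 0 \leq r \leq \frac{\pi}{4}, \\[2ex] \dfrac{2\, B\left( \frac{n-1}{2}, \frac{1}{2} \right)}{2\, B\left( \frac{n-1}{2}, \frac{1}{2} \right) - B\left(\sec^2 r - \frac{\sec^4 r}{4}; \frac{n-1}{2}, \frac{1}{2} \right)}, & \text{if } \frac{\pi}{4} \leq r \leq \frac{\pi}{3}. \end{cases} \]
   Context: $\mathbb{S}^n$ is the unit sphere in $\mathbb{R}^{n+1}$ with its geodesic (angular) metric. A sphere of radius $r$ in $\mathbb{S}^n$ is the set of points at geodesic distance $r$ from a centre. The kissing number $\kappa_S(n,r)$ is the maximal number of radius-$r$ spheres in $\mathbb{S}^n$ with pairwise disjoint interiors that simultaneously touch a fixed central radius-$r$ sphere. $B(x; y, z) = \int_0^x t^{y-1}(1-t)^{z-1}\,dt$ is the incomplete beta-function for $x \in [0,1]$, $y,z>0$, and $B(y,z) = B(1;y,z)$.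
   Formalization: At r = 0, where spheres are points with empty interior and the literal kissing number is degenerate (the bound fails, e.g. 3 for n = 2), κ_S(n,0) is taken to be the Euclidean kissing number of R^n; for r > 0 the definition is the literal one. *)

(* Defs.v *)
From HB Require Import structures.
From mathcomp Require Import all_boot all_order all_algebra.
From mathcomp Require Import all_classical all_reals all_analysis.

Set Implicit Arguments.
Unset Strict Implicit.
Unset Printing Implicit Defensive.

Import Order.TTheory GRing.Theory Num.Theory.
Import numFieldNormedType.Exports.

Local Open Scope classical_set_scope.
Local Open Scope ring_scope.

Definition dot (R : realType) (n : nat) (x y : 'rV[R]_n) : R :=
  \sum_(i < n) x 0 i * y 0 i.

(* The norm carried by 'rV[R]_n in the library is the sup norm, whence this
   explicit Euclidean distance. *)
Definition euclidean_dist (R : realType) (n : nat) (x y : 'rV[R]_n) : R :=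
  Num.sqrt (dot (x - y) (x - y)).

(* S^n, as a subset of R^(n+1) *)
Definition unit_sphere (R : realType) (n : nat) : set 'rV[R]_n.+1 :=
  [set x | dot x x = 1].

Definition angular_dist (R : realType) (n : nat) (x y : 'rV[R]_n.+1) : R :=
  acos (dot x y).

Section Kissing.
Context (R : realType) (T : Type) (X : set T) (d : T -> T -> R).

Definition geosphere (c : T) (r : R) : set T := [set x | X x /\ d c x = r].

Definition geosphere_interior (c : T) (r : R) : set T :=
  [set x | X x /\ d c x < r].

Definition disjoint_interiors (r : R) (a b : T) : Prop :=
  geosphere_interior a r `&` geosphere_interior b r = set0.

(* External tangency: two spheres of the same radius touch when they have a
   common point but no common interior point. *)
Definition touch (r : R) (a b : T) : Prop :=
  geosphere a r `&` geosphere b r !=set0 /\ disjoint_interiors r a b.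

Definition kissing_configuration (r : R) (m : nat) (c0 : T) (c : 'I_m -> T) :=
  [/\ X c0,
      forall i, X (c i),
      forall i, touch r c0 (c i) &
      forall i j, i != j -> disjoint_interiors r (c i) (c j)].

(* The supremum, in the extended reals, of the possible numbers of spheres. *)
Definition kissing_number (r : R) : \bar R :=
  ereal_sup [set (m%:R)%:E | m in
    [set m : nat | exists (c0 : T) (c : 'I_m -> T),
       kissing_configuration r c0 c]].

End Kissing.

Definition euclidean_kissing_number (R : realType) (n : nat) : \bar R :=
  kissing_number [set: 'rV[R]_n] (@euclidean_dist R n) 1.

(* Spheres of radius 0 are single points, with empty interiors, for which the
   notion degenerates; as usual, the value at r = 0 is that of the flat
   limiting geometry, the kissing number of R^n. *)
Definition kappaS (R : realType) (n : nat) (r : R) : \bar R :=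
  if r == 0 then euclidean_kissing_number R n
  else kissing_number (@unit_sphere R n) (@angular_dist R n) r.

Definition inc_beta (R : realType) (x y z : R) : R :=
  \int[@lebesgue_measure R]_(t in `[0, x]) (t `^ (y - 1) * (1 - t) `^ (z - 1)).

Definition beta (R : realType) (y z : R) : R := inc_beta 1 y z.

Definition sec (R : realType) (r : R) : R := (cos r)^-1.

(* Main.v *)
(* Two spheres of radius r touching the central one have disjoint interiors as
   soon as their directions make an angle at least a, where
   cos a = 1 - sec(r)^2 / 2. A maximal family of directions with pairwise angles
   at least a is saturated: the caps of angular radius a around its points cover
   S^(n-1), so its size is at least the area of the sphere over that of a cap.

   No measure on the sphere is needed for this comparison of areas. Writing M_d
   for the functional on univariate polynomials that integrates p(<u, x>) over x
   in S^d, for u a unit vector, it is enough to know that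
   sum_i p_i(<u_i, x>) >= 0 on S^d implies sum_i M_d(p_i(|u_i| X)) >= 0. This
   follows by induction on d, slicing S^(d+1) into copies of S^d; the rotation
   invariance that makes the slices add up to M_(d+1) is an identity between the
   moments of cos and sin. The indicator of a cap is bounded above, up to a
   small constant, by polynomials (1 - t^m)^(2^m) in an affine function t of
   <u, x>. *)
Require Import Defs.
From HB Require Import structures.
From mathcomp Require Import all_boot all_order all_algebra.
From mathcomp Require Import all_classical all_reals all_analysis.
From mathcomp Require Import measurable_realfun.
From mathcomp Require Import ring lra.

Set Implicit Arguments.
Unset Strict Implicit.
Unset Printing Implicit Defensive.

Import Order.TTheory GRing.Theory Num.Theory.
Import numFieldNormedType.Exports.

Local Open Scope classical_set_scope.
Local Open Scope ring_scope.

(** * Bilinearity of the scalar product *)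

Section DotProduct.
Context {R : realType}.

Lemma dot_row_mx n (a : R) (u : 'rV[R]_n) x (y : 'rV[R]_n) :
  dot (row_mx a%:M u) (row_mx x%:M y) = a * x + dot u y.
Proof.
rewrite /dot big_split_ord/= big_ord1 !row_mxEl !mxE !eqxx !mulr1n; congr (_ + _).
by apply: eq_bigr => i _; rewrite !row_mxEr.
Qed.

Lemma dotZr n (c : R) (x y : 'rV[R]_n) : dot x (c *: y) = c * dot x y.
Proof. by rewrite /dot mulr_sumr; apply: eq_bigr => i _; rewrite mxE; ring. Qed.

Lemma dotZl n (c : R) (x y : 'rV[R]_n) : dot (c *: x) y = c * dot x y.
Proof. by rewrite /dot mulr_sumr; apply: eq_bigr => i _; rewrite mxE; ring. Qed.

Lemma dot_ge0 n (x : 'rV[R]_n) : 0 <= dot x x.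
Proof. by apply: sumr_ge0 => i _; rewrite -expr2 sqr_ge0. Qed.

Lemma dot_delta_mx n (i : 'I_n) : dot (delta_mx 0 i : 'rV[R]_n) (delta_mx 0 i) = 1.
Proof.
rewrite /dot (bigD1 i)//= big1 => [|j ji]; first by rewrite mxE !eqxx mulr1 addr0.
by rewrite mxE (negbTE ji) mul0r.
Qed.

Lemma dotC n (x y : 'rV[R]_n) : dot x y = dot y x.
Proof. by apply: eq_bigr => i _; rewrite mulrC. Qed.

Lemma dotDl n (x y z : 'rV[R]_n) : dot (x + y) z = dot x z + dot y z.
Proof. by rewrite /dot -big_split; apply: eq_bigr => i _; rewrite mxE mulrDl. Qed.

Lemma dotNl n (x y : 'rV[R]_n) : dot (- x) y = - dot x y.
Proof. by rewrite -scaleN1r dotZl mulN1r. Qed.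

Lemma dotDr n (x y z : 'rV[R]_n) : dot x (y + z) = dot x y + dot x z.
Proof. by rewrite !(dotC x) dotDl. Qed.

Lemma dotNr n (x y : 'rV[R]_n) : dot x (- y) = - dot x y.
Proof. by rewrite !(dotC x) dotNl. Qed.

Lemma dot_unit_bounded n (x y : 'rV[R]_n) : dot x x = 1 -> dot y y = 1 ->
  -1 <= dot x y <= 1.
Proof.
move=> x1 y1; have := dot_ge0 (x - y); have := dot_ge0 (x + y).
by rewrite !(dotDl, dotDr, dotNl, dotNr) x1 y1 (dotC y x); lra.
Qed.

End DotProduct.

(** * Moments of cosine and sine on [0, pi] *)

Section TrigonometricMoments.
Context {R : realType}.
Notation mu := (@lebesgue_measure R).
Implicit Types (p : {poly R}) (f g : R -> R) (a b : R).

Lemma continuous_integrable_itv a b f : continuous f ->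
  mu.-integrable `[a, b] (EFin \o f).
Proof.
move=> cf; apply: continuous_compact_integrable; first exact: segment_compact.
exact: continuous_subspaceT.
Qed.

Lemma continuous_cos_sin k q : continuous (fun t : R => cos t ^+ k * sin t ^+ q).
Proof.
move=> t; apply: cvgM; apply: (@continuous_comp _ _ _ _ (fun x : R => x ^+ _)).
- exact: continuous_cos.
- exact: exprn_continuous.
- exact: continuous_sin.
- exact: exprn_continuous.
Qed.

Lemma continuous_horner_cos_sin p q :
  continuous (fun t : R => p.[cos t] * sin t ^+ q).
Proof.
move=> t; apply: cvgM.
  apply: (@continuous_comp _ _ _ cos (fun x : R => p.[x])).
    exact: continuous_cos.
  exact: continuous_horner.
apply: (@continuous_comp _ _ _ _ (fun x : R => x ^+ _)).
  exact: continuous_sin.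
exact: exprn_continuous.
Qed.

Lemma continuous_sum (I : Type) (s : seq I) (f : I -> R -> R) :
  (forall i, continuous (f i)) -> continuous (fun t => \sum_(i <- s) f i t).
Proof.
move=> cf; elim: s => [|i s IH].
  by under eq_fun do rewrite big_nil; exact: cst_continuous.
under eq_fun do rewrite big_cons.
by move=> t; apply: cvgD; [exact: cf|exact: IH].
Qed.

Lemma Rintegral_sum_continuous (I : Type) (s : seq I) (f : I -> R -> R) a b :
  (forall i, continuous (f i)) ->
  \int[mu]_(t in `[a, b]) (\sum_(i <- s) f i t) =
  \sum_(i <- s) \int[mu]_(t in `[a, b]) f i t.
Proof.
move=> cf; elim: s => [|i s IH].
  rewrite big_nil; under eq_Rintegral do rewrite big_nil.
  by rewrite Rintegral_cst// mul0r.
rewrite big_cons -IH; under eq_Rintegral do rewrite big_cons.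
rewrite RintegralD//; apply: continuous_integrable_itv => //.
exact: continuous_sum.
Qed.

Lemma RintegralZ_continuous f a b (c : R) : continuous f ->
  \int[mu]_(t in `[a, b]) (c * f t) = c * \int[mu]_(t in `[a, b]) f t.
Proof. by move=> cf; rewrite RintegralZl//; exact: continuous_integrable_itv. Qed.

Definition cos_sin_integral k q : R :=
  \int[mu]_(t in `[0, pi]) (cos t ^+ k * sin t ^+ q).

Local Notation J := cos_sin_integral.

Lemma cos_sin_integral_sin2 k q : J k q.+2 = J k q - J k.+2 q.
Proof.
rewrite -RintegralB//; try exact/continuous_integrable_itv/continuous_cos_sin.
apply: eq_Rintegral => t _.
by rewrite -[q.+2]addn2 -[k.+2]addn2 !exprD sin2cos2; ring.
Qed.

Lemma Rintegral_FTC (F f : R -> R) b : 0 < b -> continuous f ->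
  (forall t : R, is_derive t 1 F (f t)) ->
  \int[mu]_(t in `[0, b]) f t = F b - F 0.
Proof.
move=> b0 cf dF; rewrite /Rintegral.
have cF : continuous F.
  by move=> t; apply/differentiable_continuous/derivable1_diffP; case: (dF t).
rewrite (@continuous_FTC2 _ f F)//.
- exact: continuous_subspaceT.
- split=> [t _| |].
  + by case: (dF t).
  + by apply: cvg_at_right_filter; exact: cF.
  + by apply: cvg_at_left_filter; exact: cF.
- by move=> t _; rewrite derive1E; case: (dF t).
Qed.

(** Both sides differ by the integral of the derivative of cos^(k+1) sin^(q+1), which vanishes at 0
    and at pi because q + 1 > 0. *)
Lemma cos_sin_integral_parts k q :
  q.+1%:R * J k.+2 q = k.+1%:R * J k q.+2.
Proof.
have c1 := @continuous_cos_sin k.+2 q; have c2 := @continuous_cos_sin k q.+2.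
have d1 : continuous (fun t : R => q.+1%:R * (cos t ^+ k.+2 * sin t ^+ q)).
  by move=> t; apply: cvgM; [exact: cvg_cst|exact: c1].
have d2 : continuous (fun t : R => k.+1%:R * (cos t ^+ k * sin t ^+ q.+2)).
  by move=> t; apply: cvgM; [exact: cvg_cst|exact: c2].
apply/eqP; rewrite -subr_eq0 -!RintegralZ_continuous// -RintegralB//; last 2 first.
- exact: continuous_integrable_itv.
- exact: continuous_integrable_itv.
have dF (t : R) : is_derive t 1 (fun t => cos t ^+ k.+1 * sin t ^+ q.+1)
    (q.+1%:R * (cos t ^+ k.+2 * sin t ^+ q) -
     k.+1%:R * (cos t ^+ k * sin t ^+ q.+2)).
  have dc := is_deriveX k.+1 (is_derive_cos t).
  have ds := is_deriveX q.+1 (is_derive_sin t).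
  have := is_deriveM dc ds; rewrite !fctE => /is_derive_eq; apply.
  by rewrite /GRing.scale/= !exprS; ring.
rewrite (Rintegral_FTC (pi_gt0 R) _ dF); last first.
  by move=> t; apply: cvgB; [exact: d1|exact: d2].
by rewrite sin0 sinpi !expr0n/= !mulr0 subrr.
Qed.

Lemma cos_sin_integral_rec k q :
  (k + q).+2%:R * J k.+2 q = k.+1%:R * J k q.
Proof.
have := cos_sin_integral_parts k q; rewrite cos_sin_integral_sin2 mulrBr.
move/eqP; rewrite eq_sym subr_eq => /eqP ->.
by rewrite -mulrDl -natrD addSn addnS addnC.
Qed.

Lemma cos_sin_integral1 q : J 1 q = 0.
Proof.
have q0 : (q.+1%:R : R) != 0 by rewrite pnatr_eq0.
apply: (mulfI q0); rewrite mulr0 -RintegralZ_continuous; last first.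
  exact: continuous_cos_sin.
have dF (t : R) : is_derive t 1 (fun t => sin t ^+ q.+1)
    (q.+1%:R * (cos t ^+ 1 * sin t ^+ q)).
  have := is_deriveX q.+1 (is_derive_sin t); rewrite fctE => /is_derive_eq; apply.
  by rewrite /GRing.scale/=; ring.
rewrite (Rintegral_FTC (pi_gt0 R) _ dF).
  by rewrite sin0 sinpi !expr0n/= subrr.
by move=> t; apply: cvgM; [exact: cvg_cst|exact: continuous_cos_sin].
Qed.

(** The recurrence lowers k by two, down to k = 1, where sin^(q+1) is an antiderivative up to a
    factor. *)
Lemma cos_sin_integral_odd k q : odd k -> J k q = 0.
Proof.
elim/ltn_ind: k => -[//|[_ _|k IH]]; first exact: cos_sin_integral1.
rewrite /= negbK => ok; have kq0 : ((k + q).+2%:R : R) != 0 by rewrite pnatr_eq0.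
by apply: (mulfI kq0); rewrite cos_sin_integral_rec IH// !mulr0.
Qed.

End TrigonometricMoments.

(** * Zonal integrals, slicing and positivity *)

Section ZonalFunctional.
Context {R : realType}.
Notation mu := (@lebesgue_measure R).
Implicit Types (p : {poly R}) (a b : R).
Local Notation J := (@cos_sin_integral R).

(* Up to a factor depending on d, the integral of p(<u, x>) over x in S^d, for
   any unit vector u; the latitude t has density sin(t)^(d-1). *)
Definition zonal d p : R :=
  if d is q.+1 then \int[mu]_(t in `[0, pi]) (p.[cos t] * sin t ^+ q)
  else (p.[1] + p.[-1]) / 2.

Lemma zonalD d p p' : zonal d (p + p') = zonal d p + zonal d p'.
Proof.
case: d => [|q] /=; first by rewrite !hornerD; ring.
rewrite -RintegralD//; try exact/continuous_integrable_itv/continuous_horner_cos_sin.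
by apply: eq_Rintegral => t _; rewrite hornerD mulrDl.
Qed.

Lemma zonalZ d c p : zonal d (c *: p) = c * zonal d p.
Proof.
case: d => [|q] /=; first by rewrite !hornerZ; ring.
rewrite -RintegralZ_continuous; last exact: continuous_horner_cos_sin.
by apply: eq_Rintegral => t _; rewrite hornerZ mulrA.
Qed.

Lemma zonal_sum d (I : Type) (s : seq I) (F : I -> {poly R}) :
  zonal d (\sum_(i <- s) F i) = \sum_(i <- s) zonal d (F i).
Proof.
elim: s => [|i s IH]; last by rewrite !big_cons zonalD IH.
by rewrite !big_nil -(scale0r 0) zonalZ mul0r.
Qed.

Lemma zonalSXn q k : zonal q.+1 'X^k = J k q.
Proof. by apply: eq_Rintegral => t _; rewrite hornerXn. Qed.

Lemma zonalXn_odd d k : odd k -> zonal d 'X^k = 0.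
Proof.
case: d => [|q] ok; last by rewrite zonalSXn cos_sin_integral_odd.
by rewrite /= !hornerXn expr1n -signr_odd ok expr1 subrr mul0r.
Qed.

(** This also covers the two-point sphere d = 0, where the moments depend only on the parity of
    k. *)
Lemma zonalXn_rec d k : (k + d).+1%:R * zonal d 'X^(k.+2) = k.+1%:R * zonal d 'X^k.
Proof.
case: d => [|q]; last by rewrite !zonalSXn addnS cos_sin_integral_rec.
by rewrite addn0 /= !hornerXn !expr1n !exprS mulrA mulrNN !mul1r.
Qed.

Lemma zonal_comp_affine d p a b :
  zonal d (p \Po (a%:P + b *: 'X)) =
  \sum_(k < size p) p`_k * \sum_(j < k.+1)
     'C(k, j)%:R * a ^+ (k - j) * b ^+ j * zonal d 'X^j.
Proof.
rewrite comp_polyE zonal_sum; apply: eq_bigr => k _; rewrite zonalZ; congr (_ * _).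
rewrite exprDn zonal_sum; apply: eq_bigr => j _.
rewrite -scaler_nat zonalZ exprZn -scalerAr zonalZ -rmorphXn/= mul_polyC zonalZ.
ring.
Qed.

Lemma zonal_comp_scale d p c :
  zonal d (p \Po (c *: 'X)) = \sum_(k < size p) p`_k * (c ^+ k * zonal d 'X^k).
Proof.
rewrite comp_polyE zonal_sum; apply: eq_bigr => k _.
by rewrite zonalZ exprZn zonalZ.
Qed.

(** This compares the even coefficients in [zonal_moment_slice]. The induction goes from (e + 1, i)
    to (e, i + 1): the sum is constant, so the last moment on the right does not change, and every
    other factor changes by an explicit ratio. *)
Lemma bin_double_moment d e i :
  'C((e + i).*2, i.*2)%:R * zonal d 'X^(i.*2) * J e.*2 (i.*2 + d) =
  'C(e + i, i)%:R * zonal d 1 * J (e + i).*2 d.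
Proof.
elim: i e => [|i IH] e; first by rewrite !addn0 !bin0 expr0.
have nz (k : nat) : (k.+1%:R : R) != 0 by rewrite pnatr_eq0.
have {}IH := IH e.+1; rewrite addSnnS in IH.
have e0 : ((e + i.+1).*2 - i.*2 = e.*2.+2)%N.
  by rewrite -doubleB addnS subSn ?leq_addl// addnK.
have e1 : ((e + i.+1).*2 - i.*2.+1 = e.*2.+1)%N by rewrite subnS e0.
have e2 : (e + i.+1 - i = e.+1)%N by rewrite addnS subSn ?leq_addl// addnK.
have /(congr1 (fun n => n%:R : R)) := mul_bin_left (e + i.+1).*2 i.*2.
rewrite e0 !natrM => /(canRL (mulKf (nz _))) C1.
have /(congr1 (fun n => n%:R : R)) := mul_bin_left (e + i.+1).*2 i.*2.+1.
rewrite e1 !natrM C1 => /(canRL (mulKf (nz _))) {C1} C2.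
have /(congr1 (fun n => n%:R : R)) := mul_bin_left (e + i.+1) i.
rewrite e2 !natrM => /(canRL (mulKf (nz _))) C3.
have /(canRL (mulKf (nz _))) Hm := zonalXn_rec d i.*2.
have /esym/(canRL (mulKf (nz _))) HJ := @cos_sin_integral_parts R e.*2 (i.*2 + d).
rewrite !doubleS !addSn in HJ IH *.
(* The ratios (2e+2)(2e+1)/((2i+1)(2i+2)), (2i+1)/(2i+d+1) and (2i+d+1)/(2e+1), of the binomial,
   [zonal] and [J] factors, multiply to (e+1)/(i+1). *)
transitivity (e.+1%:R / i.+1%:R *
    ('C((e + i.+1).*2, i.*2)%:R * zonal d 'X^(i.*2) * J e.*2.+2 (i.*2 + d))).
  rewrite C2 Hm HJ -!muln2 -!natr1 !natrD !natrM.
  have := nz i; have := nz e; have := nz i.*2.+1; have := nz i.*2.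
  have := nz (i.*2 + d)%N; have := nz e.*2.
  rewrite -!muln2 -!natr1 !natrD !natrM => n1 n2 n3 n4 n5 n6.
  by field; rewrite n1 n2 n3 n4 n6.
by rewrite IH C3; move: (nz i); set z := i.+1%:R => z0; field.
Qed.

Lemma big_ord_double (F : nat -> R) l :
  \sum_(j < l.*2.+1) F j = \sum_(i < l.+1) F i.*2 + \sum_(i < l) F i.*2.+1.
Proof.
elim: l => [|l IH]; first by rewrite big_ord0 addr0 !big_ord1.
rewrite doubleS 2!big_ord_recr /= IH [in RHS]big_ord_recr.
by rewrite [X in _ = _ + X]big_ord_recr /=; ring.
Qed.

(* The moment form of the invariance of the uniform measure of the sphere: the
   left-hand side integrates the k-th power of a linear form over S^(d+1) by
   slices, the right-hand side does the same after a rotation. *)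
Lemma zonal_moment_slice d k a b c : c ^+ 2 = a ^+ 2 + b ^+ 2 ->
  \sum_(j < k.+1) 'C(k, j)%:R * a ^+ (k - j) * b ^+ j * zonal d 'X^j *
    J (k - j) (j + d) = zonal d 1 * (c ^+ k * J k d).
Proof.
move=> cab; have [ok|ek] := boolP (odd k).
  (* For k odd, either j or k - j is odd, so one of the two moments in each term vanishes. *)
  rewrite (cos_sin_integral_odd _ ok) !mulr0 big1// => j _.
  have jk : (j <= k)%N by rewrite -ltnS.
  have [oj|ej] := boolP (odd j); first by rewrite zonalXn_odd// mulr0 mul0r.
  by rewrite cos_sin_integral_odd ?mulr0// oddB// ok (negbTE ej).
have -> : k = k./2.*2 by rewrite even_halfK.
move: k./2 => l {k ek}.
rewrite (big_ord_double (fun j => 'C(l.*2, j)%:R * a ^+ (l.*2 - j) * b ^+ j *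
  zonal d 'X^j * J (l.*2 - j) (j + d))).
rewrite [X in _ + X]big1 ?addr0; last first.
  by move=> i _; rewrite zonalXn_odd ?mulr0 ?mul0r//= odd_double.
(* The surviving even terms are matched one by one with the binomial expansion of (a^2 + b^2)^l. *)
rewrite -mul2n exprM cab exprDn mul2n mulr_suml mulr_sumr; apply: eq_bigr => i _.
have il : (i <= l)%N by rewrite -ltnS.
have := bin_double_moment d (l - i) i; rewrite subnK// -doubleB.
rewrite -[_ ^+ (l - i)]exprM -[_ ^+ i]exprM !mul2n => H.
transitivity (a ^+ (l - i).*2 * b ^+ i.*2 *
  ('C(l.*2, i.*2)%:R * zonal d 'X^(i.*2) * J (l - i).*2 (i.*2 + d))); first by ring.
by rewrite H -mulr_natr; ring.
Qed.

(** Separates t from the coefficients: continuity in t and termwise integration become immediate. *)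
Lemma zonal_sliceE d p a b (t : R) :
  zonal d (p \Po ((a * cos t)%:P + (b * sin t) *: 'X)) * sin t ^+ d =
  \sum_(k < size p) p`_k * \sum_(j < k.+1)
    ('C(k, j)%:R * a ^+ (k - j) * b ^+ j * zonal d 'X^j) *
    (cos t ^+ (k - j) * sin t ^+ (j + d)).
Proof.
rewrite zonal_comp_affine mulr_suml; apply: eq_bigr => k _.
rewrite -mulrA mulr_suml; congr (_ * _); apply: eq_bigr => j _.
by rewrite !exprMn exprD; ring.
Qed.

Lemma continuous_scale (c : R) (f : R -> R) :
  continuous f -> continuous (fun t => c * f t).
Proof. by move=> cf t; apply: cvgM; [exact: cvg_cst|exact: cf]. Qed.

Lemma continuous_zonal_slice d p a b :
  continuous (fun t : R =>
    zonal d (p \Po ((a * cos t)%:P + (b * sin t) *: 'X)) * sin t ^+ d).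
Proof.
under eq_fun do rewrite zonal_sliceE.
apply: continuous_sum => k; apply: continuous_scale.
by apply: continuous_sum => j; apply: continuous_scale; exact: continuous_cos_sin.
Qed.

(** Fubini for a linear form on S^(d+1): a is the polar component of its vector, b the length of the
    rest and c the full length. The factor [zonal d 1] comes from the normalisation of [zonal]. *)
Lemma zonal_slice d p a b c : c ^+ 2 = a ^+ 2 + b ^+ 2 ->
  \int[mu]_(t in `[0, pi])
    (zonal d (p \Po ((a * cos t)%:P + (b * sin t) *: 'X)) * sin t ^+ d) =
  zonal d 1 * zonal d.+1 (p \Po (c *: 'X)).
Proof.
move=> cab; rewrite zonal_comp_scale mulr_sumr.
under eq_Rintegral do rewrite zonal_sliceE.
rewrite Rintegral_sum_continuous; last first.
  move=> k; apply: continuous_scale; apply: continuous_sum => j.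
  by apply: continuous_scale; exact: continuous_cos_sin.
apply: eq_bigr => k _; rewrite RintegralZ_continuous; last first.
  apply: continuous_sum => j.
  by apply: continuous_scale; exact: continuous_cos_sin.
rewrite mulrCA zonalSXn -(zonal_moment_slice d k cab); congr (_ * _).
rewrite Rintegral_sum_continuous; last first.
  by move=> j; apply: continuous_scale; exact: continuous_cos_sin.
apply: eq_bigr => j _; rewrite RintegralZ_continuous//.
exact: continuous_cos_sin.
Qed.

Lemma cos_sin_integral0_gt0 q : 0 < J 0 q.
Proof.
(* The recurrence advances by two, so consecutive values are carried together. *)
have [q0 q1] : 0 < J 0 q /\ 0 < J 0 q.+1; last by [].
elim: q => [|q [IH IH1]]; last first.
  split => //; rewrite cos_sin_integral_sin2.
  have q2 : (q.+2%:R : R) != 0 by rewrite pnatr_eq0.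
  have /(canRL (mulKf q2)) -> := cos_sin_integral_rec (R := R) 0 q.
  rewrite mul1r -[X in X - _]mul1r -mulrBl mulr_gt0//.
  by rewrite subr_gt0 invf_lt1 ?ltr1n ?ltr0n.
split.
  rewrite /cos_sin_integral; under eq_Rintegral do rewrite !expr0 mulr1.
  rewrite Rintegral_cst//= lebesgue_measure_itv/= lte_fin pi_gt0 mul1r.
  by rewrite -EFinB/= subr0 pi_gt0.
have dF (t : R) : is_derive t 1 (fun t => - cos t) (cos t ^+ 0 * sin t ^+ 1).
  have := is_deriveN (is_derive_cos t); rewrite fctE => /is_derive_eq; apply.
  by rewrite opprK expr0 mul1r.
rewrite /cos_sin_integral (Rintegral_FTC (pi_gt0 R) _ dF).
  by rewrite cospi cos0 opprK; lra.
exact: continuous_cos_sin.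
Qed.

Lemma zonal1_gt0 d : 0 < zonal d 1.
Proof.
case: d => [|q]; first by rewrite /= !hornerE; lra.
by rewrite -(expr0 'X) zonalSXn cos_sin_integral0_gt0.
Qed.

(** Writing u_i = (a_i, v_i) and x = (cos t, sin t y) gives <u_i, x> = a_i cos t + sin t <v_i, y>.
    Slicing thus yields vectors v_i of any length and polynomials that depend on i, so the statement
    must allow both for the induction to close. *)
Lemma zonal_positivity d m (p : 'I_m -> {poly R}) (u : 'I_m -> 'rV[R]_d.+1) :
  (forall x, dot x x = 1 -> 0 <= \sum_i (p i).[dot (u i) x]) ->
  0 <= \sum_i zonal d (p i \Po (Num.sqrt (dot (u i) (u i)) *: 'X)).
Proof.
elim: d p u => [|d IH] p u H.
  have {}H e : e ^+ 2 = 1 -> 0 <= \sum_i (p i).[u i 0 0 * e].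
    move=> e1; have := H (const_mx e); rewrite /dot big_ord1 !mxE -expr2 => /(_ e1).
    by under eq_bigr do rewrite big_ord1 mxE.
  (* On S^0 the norm of u_i is its absolute value; a change of sign only swaps the two points. *)
  have -> : \sum_i zonal 0 (p i \Po (Num.sqrt (dot (u i) (u i)) *: 'X)) =
      (\sum_i (p i).[u i 0 0 * 1] + \sum_i (p i).[u i 0 0 * -1]) / 2.
    rewrite -big_split mulr_suml; apply: eq_bigr => i _ /=; congr (_ / _).
    rewrite !horner_comp !hornerE /dot big_ord1 -expr2 sqrtr_sqr.
    by case: ger0P => _; rewrite ?mulr1 ?mulrN1 ?opprK// addrC.
  by rewrite divr_ge0// addr_ge0// H// ?sqrrN ?expr1n.
pose a i : R := u i 0 0; pose v i : 'rV[R]_d.+1 := rsubmx (u i : 'rV_(1 + d.+1)).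
have uE i : u i = row_mx (a i)%:M (v i).
  have -> : (a i)%:M = lsubmx (u i : 'rV_(1 + d.+1)).
    by apply/rowP => j; rewrite !ord1 !mxE eqxx mulr1n; congr (u i _ _); exact/val_inj.
  by rewrite hsubmxK.
pose b i := Num.sqrt (dot (v i) (v i)).
have slice (t : R) : 0 <= \sum_i
    zonal d (p i \Po ((a i * cos t)%:P + (b i * sin t) *: 'X)).
  have -> : \sum_i zonal d (p i \Po ((a i * cos t)%:P + (b i * sin t) *: 'X)) =
      \sum_i zonal d ((p i \Po ((a i * cos t)%:P + sin t *: 'X)) \Po (b i *: 'X)).
    apply: eq_bigr => i _; rewrite -comp_polyA comp_polyD comp_polyC comp_polyZ.
    by rewrite comp_polyX scalerA [sin t * _]mulrC.
  apply: IH => y y1.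
  have := H (row_mx (cos t)%:M (sin t *: y)).
  rewrite dot_row_mx dotZr dotZl y1 mulr1 -!expr2 cos2Dsin2 => /(_ erefl).
  congr (0 <= _); apply: eq_bigr => i _.
  by rewrite uE dot_row_mx dotZr horner_comp !hornerE.
(* The positive factor [zonal d 1] turns the sum into the integral over all slices. *)
rewrite -(pmulr_rge0 _ (zonal1_gt0 d)) mulr_sumr.
have -> : \sum_i zonal d 1 *
      zonal d.+1 (p i \Po (Num.sqrt (dot (u i) (u i)) *: 'X)) =
    \int[mu]_(t in `[0, pi]) \sum_i
      (zonal d (p i \Po ((a i * cos t)%:P + (b i * sin t) *: 'X)) * sin t ^+ d).
  rewrite Rintegral_sum_continuous; last by move=> i; exact: continuous_zonal_slice.
  apply: eq_bigr => i _; rewrite (@zonal_slice _ _ _ _ (Num.sqrt (dot (u i) (u i))))//.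
  by rewrite !sqr_sqrtr ?dot_ge0// {1 2}uE dot_row_mx.
apply: Rintegral_ge0 => t; rewrite /= in_itv/= => t0pi.
by rewrite -mulr_suml mulr_ge0 ?exprn_ge0 ?sin_ge0_pi.
Qed.

End ZonalFunctional.

(** * Polynomial approximation of a step function *)

Section StepPolynomial.
Context {R : realType}.

Lemma bernoulli (x : R) n : -1 <= x -> 1 + n%:R * x <= (1 + x) ^+ n.
Proof.
move=> x1; elim: n => [|n IH]; first by rewrite mul0r addr0 expr0.
have h : 0 <= 1 + x by lra.
rewrite exprS -natr1; apply: le_trans (ler_wpM2l h IH).
have : 0 <= n%:R * x ^+ 2 by rewrite mulr_ge0 ?sqr_ge0.
by nra.
Qed.

(** Bernoulli gives the first bound, and the second follows with the same exponent because 1 - k <=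
    1 / (1 + k). *)
Lemma powers_le (k e : R) : 0 < k -> 0 < e ->
  exists m, (1 + k) ^- m <= e /\ (k <= 1 -> (1 - k) ^+ m <= e).
Proof.
move=> k0 e0; pose m := Num.bound (e^-1 / k); exists m.
have ke : e^-1 <= (1 + k) ^+ m.
  have : e^-1 / k <= m%:R.
    by apply/ltW/archi_boundP; rewrite divr_ge0 ?invr_ge0; lra.
  rewrite ler_pdivrMr// => /le_trans; apply.
  apply: le_trans (bernoulli _ _); last by lra.
  lra.
have V : (1 + k) ^- m <= e.
  by rewrite -[e]invrK lef_pV2// posrE ?invr_gt0 ?exprn_gt0//; lra.
split=> // k1; apply: le_trans V; rewrite -exprVn; apply: lerXn2r.
- by rewrite nnegrE; lra.
- by rewrite nnegrE invr_ge0; lra.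
- by rewrite -[X in _ <= X]mul1r ler_pdivlMr; nra.
Qed.

(** With T = 1/2 + (s - x)/4, which lies in [0, 1] and equals 1/2 at the threshold x = s, take (1 -
    T^m)^(2^m). Since 2^m T^m = (2T)^m, its size depends on whether 2T is below 1 - h/2 or above 1 +
    h/2. *)
Lemma step_polynomial (s h e : R) : -1 <= s <= 1 -> 0 < h -> 0 < e ->
  exists p : {poly R}, forall x, -1 <= x <= 1 ->
    [/\ 0 <= p.[x] <= 1, s + h <= x -> 1 - e <= p.[x] &
        x <= s - h -> p.[x] <= e].
Proof.
move=> s1 h0 e0; have k0 : 0 < h / 2 by lra.
have [m [mV mB]] := powers_le k0 e0.
move: s1 h0 e0 => /andP[s1 s1'] h0 e0.
exists ((1 - ((2^-1 + s / 4)%:P - 4^-1 *: 'X) ^+ m) ^+ (2 ^ m)) => x /andP[x1 x1'].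
rewrite !(hornerE, horner_exp).
set T := (2^-1 + s / 4 - _); have ET : T = 2^-1 + s / 4 - 4^-1 * x by [].
have T0 : 0 <= T by lra.
have T1 : T <= 1 by lra.
have Tm0 : 0 <= T ^+ m by rewrite exprn_ge0.
have Tm1 : T ^+ m <= 1 by rewrite exprn_ile1.
have E : (2 ^ m)%:R * T ^+ m = (2 * T) ^+ m by rewrite exprMn natrX.
split.
- by rewrite exprn_ge0 ?exprn_ile1//; lra.
- move=> sx; apply: le_trans (@bernoulli (- T ^+ m) (2 ^ m) _); last by lra.
  rewrite mulrN E lerD2l lerN2; apply: le_trans (mB _); last by lra.
  by apply: lerXn2r; rewrite ?nnegrE; lra.
- move=> xs; apply: le_trans mV.
  have k1 : 0 < (1 + h / 2) ^+ m by rewrite exprn_gt0; lra.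
  rewrite -[X in _ <= X]mul1r ler_pdivlMr//.
  have P0 : 0 <= (1 - T ^+ m) ^+ (2 ^ m) by rewrite exprn_ge0; lra.
  (* The added factor is at least (2T)^m by Bernoulli, while the product is (1 - T^(2m))^(2^m) <=
     1. *)
  apply: (@le_trans _ _ ((1 - T ^+ m) ^+ (2 ^ m) * (1 + T ^+ m) ^+ (2 ^ m))).
    apply: ler_wpM2l => //; apply: le_trans (bernoulli _ _); last by lra.
    rewrite E; apply: (@le_trans _ _ ((2 * T) ^+ m)); last by lra.
    by apply: lerXn2r; rewrite ?nnegrE; lra.
  by rewrite -exprMn exprn_ile1//; nra.
Qed.
End StepPolynomial.

(** * Areas of caps and coverings of the sphere *)

Section Covering.
Context {R : realType}.
Notation mu := (@lebesgue_measure R).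

(** Up to a constant factor, the area of a cap of angular radius a in S^(q+1). *)
Definition sin_integral q a : R := \int[mu]_(t in `[0, a]) (sin t ^+ q).
Local Notation S := sin_integral.

Lemma continuous_sin_power q : continuous (fun t : R => sin t ^+ q).
Proof.
move=> t; apply: (@continuous_comp _ _ _ _ (fun x : R => x ^+ _)).
  exact: continuous_sin.
exact: exprn_continuous.
Qed.

Lemma Rintegral_split (f : R -> R) a : continuous f -> 0 <= a <= pi ->
  \int[mu]_(t in `[0, pi]) f t =
  \int[mu]_(t in `[0, a]) f t + \int[mu]_(t in `]a, pi]) f t.
Proof.
move=> cf /andP[a0 api].
rewrite -(@Rintegral_itvB _ f (BLeft 0) (BRight pi) a) ?bnd_simp//.
  by rewrite addrC subrK.
exact: continuous_integrable_itv.
Qed.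

Lemma zonal1_sin_integral q : zonal q.+1 (1 : {poly R}) = S q pi.
Proof. by apply: eq_Rintegral => t _; rewrite hornerC mul1r. Qed.

Lemma integrable_itv_oc (f : R -> R) a b : continuous f ->
  mu.-integrable `]a, b] (EFin \o f).
Proof.
move=> cf; apply: integrableS (continuous_integrable_itv a b cf) => //.
exact: subset_itv_oc_cc.
Qed.

(** The integrand lies in [0, 1]. The Lipschitz bound controls the slight enlargement of the caps in
    [cover_sin_integral]. *)
Lemma sin_integral_incr q a b : 0 <= a -> a <= b -> b <= pi ->
  S q a <= S q b <= S q a + (b - a).
Proof.
move=> a0 ab bpi.
have c := @continuous_sin_power q.
have : S q b - S q a = \int[mu]_(t in `]a, b]) (sin t ^+ q).
  by apply: Rintegral_itvB; rewrite ?bnd_simp//; exact: continuous_integrable_itv.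
have : 0 <= \int[mu]_(t in `]a, b]) (sin t ^+ q).
  apply: Rintegral_ge0 => t; rewrite /= in_itv/= => tab.
  by rewrite exprn_ge0// sin_ge0_pi//; lra.
have : \int[mu]_(t in `]a, b]) (sin t ^+ q) <= \int[mu]_(t in `]a, b]) 1.
  apply: le_Rintegral => //.
  - exact: integrable_itv_oc.
  - by apply: integrable_itv_oc; exact: cst_continuous.
rewrite Rintegral_cst//= lebesgue_measure_itv/= lte_fin.
case: ltP => /= ?; lra.
Qed.

Lemma sin_integral0 q : S q 0 = 0.
Proof. by rewrite /S set_itv1 Rintegral_set1. Qed.

Lemma sin_integral_pi_gt0 q : 0 < S q pi.
Proof. by rewrite -zonal1_sin_integral zonal1_gt0. Qed.

Lemma zonal_le_sin_integral q (p : {poly R}) a (e : R) : 0 <= e -> 0 <= a <= pi ->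
  (forall x, -1 <= x <= 1 -> p.[x] <= 1 + e) ->
  (forall x, -1 <= x <= cos a -> p.[x] <= e) ->
  zonal q.+1 p <= S q a + e * S q pi.
Proof.
move=> e0 /andP[a0 api] p1 p2.
rewrite /= (@Rintegral_split _ a) ?a0//; last exact: continuous_horner_cos_sin.
have c := @continuous_sin_power q.
have s0 t : 0 <= t <= pi -> 0 <= sin t ^+ q :> R.
  by move=> ?; rewrite exprn_ge0// sin_ge0_pi.
have cs k : continuous (fun t : R => k * sin t ^+ q).
  by apply: continuous_scale; exact: c.
rewrite [X in _ + e * X]/S [in X in _ + e * X](@Rintegral_split _ a) ?a0//.
have : \int[mu]_(t in `[0, a]) (p.[cos t] * sin t ^+ q) <=
       \int[mu]_(t in `[0, a]) ((1 + e) * sin t ^+ q).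
  apply: le_Rintegral => //.
  - by apply: continuous_integrable_itv; exact: continuous_horner_cos_sin.
  - exact: continuous_integrable_itv.
  - move=> t; rewrite /= in_itv/= => ta; apply: ler_wpM2r; first by apply: s0; lra.
    by apply: p1; rewrite cos_geN1 cos_le1.
have : \int[mu]_(t in `]a, pi]) (p.[cos t] * sin t ^+ q) <=
       \int[mu]_(t in `]a, pi]) (e * sin t ^+ q).
  apply: le_Rintegral => //.
  - by apply: integrable_itv_oc; exact: continuous_horner_cos_sin.
  - exact: integrable_itv_oc.
  - move=> t; rewrite /= in_itv/= => ta; apply: ler_wpM2r; first by apply: s0; lra.
    apply: p2; rewrite cos_geN1 leNgt ltr_cos ?in_itv/= ?a0//; lra.
rewrite RintegralZ_continuous// RintegralZl//; last exact: integrable_itv_oc.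
rewrite -/(S q a); lra.
Qed.

(** If f is a polynomial majorant of the cap indicator, the covering gives sum_i f(<u_i, x>) >= 1,
    and positivity integrates this. As f needs room to decrease, caps of radius b > a are used
    first, and then b tends to a. *)
Lemma cover_sin_integral q m (u : 'I_m -> 'rV[R]_q.+2) a : 0 <= a <= pi ->
  (forall i, dot (u i) (u i) = 1) ->
  (forall x, dot x x = 1 -> exists i, cos a < dot (u i) x) ->
  S q pi <= m%:R * S q a.
Proof.
move=> /andP[a0 api'] u1 cov.
have m0 : (0 < m)%N.
  have [i _] := cov (delta_mx 0 0) (dot_delta_mx _).
  exact: leq_ltn_trans (ltn_ord i).
(* At a = pi no larger radius is available, but a single cap is enough. *)
move: api'; rewrite le_eqVlt => /predU1P[->|api].
  by rewrite ler_peMl ?(ltW (sin_integral_pi_gt0 q))// ler1n.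
have mR : 0 < m%:R :> R by rewrite ltr0n.
have step b e : a < b -> b <= pi -> 0 < e -> S q pi <= m%:R * (S q b + e * S q pi).
  move=> ab bpi e0.
  have cab : cos b < cos a by rewrite ltr_cos// in_itv/=; lra.
  have := cos_le1 a; have := cos_geN1 b => cb ca.
  (* The step is centred midway between cos b and cos a, with half the gap as margin; adding e / 2
     makes p at least 1 on the cap of radius a. *)
  have [|||p pP] :=
      @step_polynomial R ((cos a + cos b) / 2) ((cos a - cos b) / 2) (e / 2).
  - by lra.
  - by lra.
  - by lra.
  have p1 (x : R) : -1 <= x <= 1 -> 0 <= (p + (e / 2)%:P).[x] <= 1 + e.
    by move=> x1; have [] := pP x x1; rewrite !hornerE; lra.
  have p2 x : -1 <= x <= cos b -> (p + (e / 2)%:P).[x] <= e.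
    move=> x1; have x1' : -1 <= x <= 1 by lra.
    by have [_ _] := pP x x1'; rewrite !hornerE => /(_ _); lra.
  have p3 x : cos a <= x <= 1 -> 1 <= (p + (e / 2)%:P).[x].
    move=> x1; have x1' : -1 <= x <= 1 by lra.
    by have [_ + _] := pP x x1'; rewrite !hornerE => /(_ _); lra.
  move: (p + (e / 2)%:P) p1 p2 p3 => {pP} f f1 f2 f3.
  (* The constant 1 is shared equally among the m polynomials. *)
  have := @zonal_positivity R q.+1 m (fun=> f - (m%:R^-1)%:P) u.
  have -> : \sum_(i < m) zonal q.+1 ((f - (m%:R^-1)%:P) \Po
      (Num.sqrt (dot (u i) (u i)) *: 'X)) = m%:R * zonal q.+1 f - S q pi.
    under eq_bigr do rewrite u1 sqrtr1 scale1r comp_polyXr.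
    rewrite sumr_const card_ord -zonal1_sin_integral.
    rewrite -[_%:P]mulr1 mul_polyC -scaleNr zonalD zonalZ -[LHS]mulr_natl.
    by rewrite mulrDr mulNr mulrN mulrA mulfV ?gt_eqF// mul1r.
  move=> pos; apply: (@le_trans _ _ (m%:R * zonal q.+1 f)).
    rewrite -subr_ge0; apply: pos => x x1.
    under eq_bigr do rewrite hornerD hornerN hornerC.
    rewrite sumrB sumr_const card_ord -[_ *+ _]mulr_natl mulfV ?gt_eqF// subr_ge0.
    have [i ci] := cov x x1; rewrite (bigD1 i)//= -[X in X <= _]addr0 lerD//.
      by apply: f3; have := dot_unit_bounded (u1 i) x1; lra.
    apply: sumr_ge0 => j _.
    by have /andP[] := f1 _ (dot_unit_bounded (u1 j) x1).
  rewrite ler_pM2l//; apply: zonal_le_sin_integral; [lra|lra| |exact: f2].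
  by move=> x /f1 /andP[].
have S0 := sin_integral_pi_gt0 q.
apply/ler_addgt0Pr => e e0.
(* One d pays for the enlarged radius and one for the polynomial error; m(d + d) = e. *)
pose d := e / m%:R / 2.
have d0 : 0 < d by rewrite !divr_gt0.
pose b := Num.min pi (a + d).
have ab : a < b by rewrite lt_min api; lra.
have bpi : b <= pi by rewrite ge_min lexx.
have bd : b <= a + d by rewrite ge_min lexx orbT.
apply: le_trans (step b (d / S q pi) ab bpi _) _; first by rewrite divr_gt0.
rewrite divfK ?gt_eqF//.
have /andP[_ h] := sin_integral_incr q a0 (ltW ab) bpi.
have -> : e = m%:R * (d + d) by rewrite /d -splitr mulrC divfK ?gt_eqF.
by rewrite -mulrDr ler_pM2l//; lra.
Qed.

End Covering.

(** * The incomplete beta function as a cap area *)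

Section IncBeta.
Context {R : realType}.
Notation mu := (@lebesgue_measure R).
Local Notation S := (@sin_integral R).

Lemma powR_sqr (x e : R) : 0 <= x -> (x ^+ 2) `^ e = x `^ (2 * e).
Proof. by move=> x0; rewrite powRrM powR_mulrn. Qed.

(** The exponents, in the form they take in the theorem for n = q + 2, equal (q - 1)/2 and -1/2. *)
Definition beta_integrand q (t : R) : R :=
  t `^ ((q.+2%:R - 1) / 2 - 1) * (1 - t) `^ (1 / 2 - 1).

Lemma beta_integrand_sin2 q (s c : R) : 0 < s -> 0 < c -> s ^+ 2 + c ^+ 2 = 1 ->
  beta_integrand q (s ^+ 2) * (2 * s * c) = 2 * s ^+ q.
Proof.
move=> s0 c0 sc; rewrite /beta_integrand; have -> : 1 - s ^+ 2 = c ^+ 2 by lra.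
rewrite !powR_sqr ?ltW//.
have -> : 2 * ((q.+2%:R - 1) / 2 - 1) = q%:R - 1 :> R by rewrite -!natr1; field.
have -> : 2 * (1 / 2 - 1) = - 1 :> R by field.
rewrite powRB ?(gt_eqF s0) ?implybT// powR_mulrn ?ltW// powRN !powRr1 ?ltW//.
by field; rewrite !gt_eqF.
Qed.


Lemma integral_closed_open (f : R -> R) a b : measurable_fun setT f ->
  (\int[mu]_(x in `[a, b]) (f x)%:E = \int[mu]_(x in `]a, b[) (f x)%:E)%E.
Proof.
move=> mf; rewrite -integral_itv_obnd_cbnd; last first.
  by apply/measurable_EFinP; exact: measurable_funTS.
rewrite -integral_itv_bndo_bndc//.
by apply/measurable_EFinP; exact: measurable_funTS.
Qed.

Lemma sin2_lt (x y : R) : 0 <= x -> x < y -> y <= pi / 2 -> sin x ^+ 2 < sin y ^+ 2.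
Proof.
move=> x0 xy ypi; have pi0 := pi_gt0 R.
by apply: ltrXn2r => //; rewrite ?nnegrE ?sin_ge0_pi ?ltr_sin ?in_itv//=; lra.
Qed.

Lemma sin2_le (x y : R) : 0 <= x -> x <= y -> y <= pi / 2 -> sin x ^+ 2 <= sin y ^+ 2.
Proof.
by move=> x0; rewrite le_eqVlt => /predU1P[->//|xy] ypi; exact/ltW/sin2_lt.
Qed.

Lemma is_derive_sin2 (t : R) :
  is_derive t 1 (fun t => sin t ^+ 2) (2 * sin t * cos t).
Proof.
by have := is_deriveX 2 (is_derive_sin t); rewrite fctE => /is_derive_eq; apply.
Qed.

(** The interval avoids 0 and pi / 2, where the powers in the integrand may be singular. *)
Lemma beta_substitution q (a b : R) : 0 < a -> a < b -> b < pi / 2 ->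
  (\int[mu]_(t in `[(sin a ^+ 2)%R, (sin b ^+ 2)%R])
     (beta_integrand q t)%:E =
   \int[mu]_(t in `[a, b]) (2 * sin t ^+ q)%R%:E)%E.
Proof.
move=> a0 ab bpi; have pi0 := pi_gt0 R.
have F'E : derive1 (fun t : R => sin t ^+ 2) = (fun t => 2 * sin t * cos t).
  by apply/funext => t; rewrite derive1E; case: (is_derive_sin2 t).
have cF' : continuous (fun t : R => 2 * sin t * cos t).
  move=> t; apply: cvgM; last exact: continuous_cos.
  by apply: cvgM; [exact: cvg_cst|exact: continuous_sin].
have cF := @continuous_sin_power R 2.
rewrite (@integration_by_substitution_increasing _ (fun t => sin t ^+ 2)
  (beta_integrand q))//.
- apply: eq_integral => t; rewrite inE/= in_itv/= => tab; congr EFin.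
  rewrite F'E fctE /=; apply: beta_integrand_sin2.
  + by apply: sin_gt0_pihalf; lra.
  + by apply: cos_gt0_pihalf; lra.
  + by rewrite addrC cos2Dsin2.
- exact: ltW.
- by move=> x y; rewrite !in_itv/= => xab yab xy; apply: sin2_lt => //; lra.
- by rewrite F'E => t _; exact: cF'.
- by rewrite F'E; apply/cvg_ex; eexists; apply: cvg_at_right_filter; exact: cF'.
- by rewrite F'E; apply/cvg_ex; eexists; apply: cvg_at_left_filter; exact: cF'.
- split.
  + by move=> t _; case: (is_derive_sin2 t).
  + by apply: cvg_at_right_filter; exact: cF.
  + by apply: cvg_at_left_filter; exact: cF.
- have sa : 0 < sin a ^+ 2 by rewrite exprn_gt0// sin_gt0_pihalf; lra.
  have sb : sin b ^+ 2 < 1.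
    by have := @sin2_lt b (pi / 2); rewrite sin_pihalf expr1n; apply; lra.
  apply: continuous_in_subspaceT => t; rewrite inE/= in_itv/= => tab.
  have cpow (e x : R) : 0 < x -> {for x, continuous (fun x => x `^ e)}.
    move=> x0; apply/differentiable_continuous/derivable1_diffP.
    by case: (is_derive1_powR e x0).
  apply: cvgM; first by apply: cpow; lra.
  apply: (@continuous_comp _ _ _ (fun t : R => 1 - t) (fun x => x `^ (1 / 2 - 1))).
    by apply: cvgB; [exact: cvg_cst|exact: cvg_id].
  by apply: cpow; lra.
Qed.

(** The substitution t = sin^2 is applied on closed intervals that exhaust the open one; monotone
    convergence on both sides removes the restriction at the endpoints. *)
Lemma inc_beta_sin2 q (a : R) : 0 <= a <= pi / 2 ->
  inc_beta (sin a ^+ 2) ((q.+2%:R - 1) / 2) (1 / 2) = 2 * S q a.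
Proof.
rewrite /inc_beta => /andP[]; rewrite le_eqVlt => /predU1P[<- _|a0 api].
  by rewrite sin_integral0 mulr0 sin0 expr0n/= set_itv1 Rintegral_set1.
have pi0 := pi_gt0 R; have c := @continuous_sin_power R q.
rewrite -RintegralZ_continuous// /Rintegral; congr fine.
pose G := beta_integrand q; rewrite -[X in integral _ _ X]/(fun t => (G t)%:E).
have mG : measurable_fun setT G.
  apply: measurable_funM; first exact: measurable_powR.
  apply: (measurableT_comp (measurable_powR _)).
  by apply: measurable_funB => //; exact: measurable_cst.
have mH : measurable_fun setT (fun t : R => 2 * sin t ^+ q).
  by apply: continuous_measurable_fun; exact: continuous_scale.
rewrite (integral_closed_open _ _ mG) (integral_closed_open _ _ mH).
(* Starting at a / 3 makes even the first interval, [a/3, 2a/3], nondegenerate. *)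
pose lo k : R := a / k.+3%:R; pose hi k := a - lo k.
have lo0 k : 0 < lo k by rewrite divr_gt0.
have lo_le k l : (k <= l)%N -> lo l <= lo k.
  by move=> kl; rewrite ler_pM2l// lef_pV2 ?posrE// ler_nat !ltnS.
have lohi k : lo k < hi k.
  apply: (@le_lt_trans _ _ (lo 0%N)); first exact: lo_le.
  rewrite ltrBrDl -ltrBrDr; apply: (@le_lt_trans _ _ (lo 0%N)); first exact: lo_le.
  by rewrite /lo; lra.
have hia k : hi k < a by rewrite gtrBl.
have small x : 0 < x -> exists k, lo k <= x.
  move=> x0; exists (Num.bound (a / x)); rewrite ler_pdivrMr// mulrC.
  rewrite -ler_pdivrMr//; apply/ltW/(lt_le_trans (archi_boundP _)).
    by rewrite divr_ge0 ?ltW.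
  by rewrite ler_nat -addn3 leq_addr.
have covI x : 0 < x -> x < a -> exists k, lo k <= x <= hi k.
  move=> x0 xa; have [k kx] := small x x0.
  have [l lx] := small (a - x) ltac:(lra).
  exists (maxn k l); rewrite (le_trans (lo_le _ _ (leq_maxl k l)) kx)/=.
  by have := lo_le _ _ (leq_maxr k l); rewrite /hi; lra.
have EI : \bigcup_k `[lo k, hi k]%classic = `]0, a[%classic.
  apply/seteqP; split=> x /=.
    by move=> [k _] /=; rewrite !in_itv/=; have := lo0 k; have := hia k; lra.
  rewrite in_itv/= => /andP[x0 xa].
  by have [k kx] := covI x x0 xa; exists k; rewrite //= in_itv.
have EJ : \bigcup_k `[sin (lo k) ^+ 2, sin (hi k) ^+ 2]%classic =
    `]0, sin a ^+ 2[%classic.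
  apply/seteqP; split=> x /=.
    move=> [k _] /=; rewrite !in_itv/= => /andP[x1 x2].
    have h1 := lo0 k; have h2 := hia k; have h3 := lohi k.
    rewrite (lt_le_trans _ x1) ?exprn_gt0 ?sin_gt0_pihalf//=; last by lra.
    by apply: (le_lt_trans x2); apply: sin2_lt; lra.
  rewrite in_itv/= => /andP[x0 xa].
  have x1 : x <= 1.
    by apply: (le_trans (ltW xa)); have := sin2cos2 a; have := sqr_ge0 (cos a); lra.
  have sx0 : 0 <= Num.sqrt x := sqrtr_ge0 x.
  have sx1 : Num.sqrt x <= 1 by rewrite -sqrtr1 ler_wsqrtr.
  pose y := asin (Num.sqrt x).
  have siny : sin y = Num.sqrt x by rewrite /y asinK// in_itv/=; lra.
  have ylo : - (pi / 2) <= y by apply: asin_geNpi2; lra.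
  have yhi : y <= pi / 2 by apply: asin_lepi2; lra.
  have y0 : 0 < y.
    by rewrite -ltr_sin ?in_itv/= ?sin0 ?siny ?sqrtr_gt0//; lra.
  have ya : y < a.
    have sa : 0 < sin a by apply: sin_gt0_pi; lra.
    rewrite -ltr_sin ?in_itv/=; [|lra|lra].
    by rewrite siny -(gtr0_norm sa) -sqrtr_sqr ltr_sqrt// exprn_gt0.
  have [k /andP[k1 k2]] := covI y y0 ya; exists k => //=.
  have -> : x = sin y ^+ 2 by rewrite siny sqr_sqrtr// ltW.
  have h1 := lo0 k; have h2 := hia k.
  by rewrite in_itv/= !sin2_le//; lra.
have cvgI : (\int[mu]_(t in `[lo k, hi k]) (2 * sin t ^+ q)%R%:E)%E @[k --> \oo] -->
    (\int[mu]_(t in `]0%R, a[) (2 * sin t ^+ q)%R%:E)%E.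
  rewrite -EI; apply: ge0_nondecreasing_set_cvg_integral.
  - move=> k l kl; apply/subsetPset/subset_itvScc; rewrite bnd_simp; first exact: lo_le.
    by rewrite lerD2l lerN2; exact: lo_le.
  - by move=> k; exact: measurable_itv.
  - by move=> k; apply/measurable_EFinP; exact: measurable_funTS.
  - move=> k t; rewrite /= in_itv/= => tk; rewrite lee_fin mulr_ge0// exprn_ge0//.
    by have := lo0 k; have := hia k => *; rewrite sin_ge0_pi; lra.
have cvgJ : (\int[mu]_(t in `[(sin (lo k) ^+ 2)%R, (sin (hi k) ^+ 2)%R]) (G t)%:E)%E
    @[k --> \oo] --> (\int[mu]_(t in `]0%R, (sin a ^+ 2)%R[) (G t)%:E)%E.
  rewrite -EJ; apply: ge0_nondecreasing_set_cvg_integral.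
  - move=> k l kl; apply/subsetPset/subset_itvScc; rewrite bnd_simp.
      have := lo_le _ _ kl; have := lo0 l; have := lohi k; have := hia k => *.
      by apply: sin2_le; lra.
    have := lo_le _ _ kl; have := lo0 k; have := lohi k; have := hia l.
    rewrite /hi => *.
    by apply: sin2_le; lra.
  - by move=> k; exact: measurable_itv.
  - by move=> k; apply/measurable_EFinP; exact: measurable_funTS.
  - by move=> k t _; rewrite lee_fin mulr_ge0// powR_ge0.
have E k : (\int[mu]_(t in `[(sin (lo k) ^+ 2)%R, (sin (hi k) ^+ 2)%R]) (G t)%:E =
    \int[mu]_(t in `[lo k, hi k]) (2 * sin t ^+ q)%R%:E)%E.
  by apply: beta_substitution => //; have := hia k; lra.
move: cvgJ; under eq_fun do rewrite E.
by move=> cvgJ; exact: cvg_unique cvgJ cvgI.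
Qed.

(** Reflection t -> pi - t; it reduces obtuse radii to the range of [inc_beta_sin2]. *)
Lemma sin_integral_sym q (a : R) : 0 <= a <= pi -> S q (pi - a) = S q pi - S q a.
Proof.
move=> /andP[a0 api]; have c := @continuous_sin_power R q.
apply/eqP; rewrite eq_sym subr_eq addrC -subr_eq; apply/eqP.
rewrite [LHS](@Rintegral_itvB _ _ (BLeft 0) (BRight pi)); last 3 first.
- exact: continuous_integrable_itv.
- by rewrite bnd_simp subr_ge0.
- by rewrite bnd_simp gerBl.
rewrite Rintegral_itv_obnd_cbnd; last exact: integrable_itv_oc.
rewrite /S /sin_integral /Rintegral; congr fine.
pose F (t : R) := pi - t.
have dF (t : R) : is_derive t 1 F (-1).
  have := is_deriveD (is_derive_cst (pi : R) t 1) (is_deriveN (is_derive_id t 1)).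
  by rewrite !fctE => /is_derive_eq; apply; rewrite add0r.
have F'E : derive1 F = cst (-1).
  by apply/funext => t; rewrite derive1E; case: (dF t).
have cF : continuous F.
  by move=> t; apply: cvgB; [exact: cvg_cst|exact: cvg_id].
transitivity (\int[mu]_(t in `[F a, F 0%R]) (sin t ^+ q)%R%:E)%E.
  by rewrite /F subr0.
rewrite (@integration_by_substitution_decreasing R F (fun t => sin t ^+ q) 0 a a0) ?F'E.
- apply: eq_integral => t _; congr EFin.
  by rewrite !fctE opprK mulr1 /F sinB sinpi cospi mul0r mulN1r sub0r opprK.
- by move=> x y _ _; rewrite /F ltrD2l ltrN2.
- by move=> t _; exact: cst_continuous.
- exact: is_cvg_cst.
- exact: is_cvg_cst.
- split.
  + by move=> t _; case: (dF t).
  + by apply: cvg_at_right_filter; exact: cF.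
  + by apply: cvg_at_left_filter; exact: cF.
- exact: continuous_subspaceT.
Qed.
End IncBeta.

(** * Spherical codes of large size *)

Section Kissing.
Context {R : realType}.
Notation mu := (@lebesgue_measure R).
Local Notation S := (@sin_integral R).

(** The integrand dominates cos sin^q, whose integral up to b is sin(b)^(q+1)/(q+1); truncating at
    pi / 2 ensures sin b > 0. *)
Lemma sin_integral_gt0 q (a : R) : 0 < a <= pi -> 0 < S q a.
Proof.
move=> /andP[a0 api]; have pi0 := pi_gt0 R.
pose b := Num.min a (pi / 2).
have b0 : 0 < b by rewrite lt_min a0; lra.
have ba : b <= a by rewrite ge_min lexx.
have bpi : b <= pi / 2 by rewrite ge_min lexx orbT.
have /andP[Sba _] := sin_integral_incr q (ltW b0) ba api.
apply: lt_le_trans Sba.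
have q0 : 0 < q.+1%:R :> R by rewrite ltr0n.
have dF (t : R) : is_derive t 1 (fun t => sin t ^+ q.+1)
    (q.+1%:R * (cos t ^+ 1 * sin t ^+ q)).
  have := is_deriveX q.+1 (is_derive_sin t); rewrite fctE => /is_derive_eq; apply.
  by rewrite /GRing.scale/=; ring.
have cF := @continuous_cos_sin R 1 q.
have := Rintegral_FTC b0 (@continuous_scale R q.+1%:R _ cF) dF.
rewrite RintegralZ_continuous// sin0 expr0n subr0 => Fb.
apply: (@lt_le_trans _ _ (\int[mu]_(t in `[0, b]) (cos t ^+ 1 * sin t ^+ q))).
  by rewrite -(pmulr_rgt0 _ q0) Fb exprn_gt0// sin_gt0_pi//; lra.
apply: le_Rintegral => //; try apply: continuous_integrable_itv => //.
  exact: continuous_sin_power.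
move=> t; rewrite /= in_itv/= => tb; rewrite expr1 -[X in _ <= X]mul1r.
by rewrite ler_wpM2r ?cos_le1// exprn_ge0// sin_ge0_pi//; lra.
Qed.

Definition spherical_code n m (c : R) (u : 'I_m -> 'rV[R]_n) :=
  (forall i, dot (u i) (u i) = 1) /\ (forall i j, i != j -> dot (u i) (u j) <= c).

(* Gilbert-Varshamov: a code of maximal size is saturated, so that the caps of
   angular radius a around its points cover the sphere. *)
Lemma large_spherical_code q (a : R) : 0 < a <= pi ->
  exists m (u : 'I_m -> 'rV[R]_q.+2),
    spherical_code (cos a) u /\ S q pi <= m%:R * S q a.
Proof.
move=> a0pi; have Sa := sin_integral_gt0 q a0pi.
pose P m := `[< exists u : 'I_m -> 'rV[R]_q.+2, spherical_code (cos a) u >].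
(* If no code were large enough, all sizes would be below S q pi / S q a, so a maximal one would
   exist. *)
have [//|no] := pselect (exists m (u : 'I_m -> 'rV[R]_q.+2),
  spherical_code (cos a) u /\ S q pi <= m%:R * S q a).
have small m (u : 'I_m -> 'rV[R]_q.+2) : spherical_code (cos a) u ->
    m%:R * S q a < S q pi.
  by move=> cu; rewrite ltNge; apply/negP => h; apply: no; exists m, u.
have P0 : exists m, P m.
  by exists 0%N; apply/asboolP; exists (fun=> 0); split=> [[]|[]].
have Pb m : P m -> (m <= Num.bound (S q pi / S q a))%N.
  move=> /asboolP[u /small]; rewrite -ltr_pdivlMr// => h.
  rewrite -(ler_nat R); apply/ltW/(lt_trans h)/archi_boundP.
  by rewrite divr_ge0 ?ltW// sin_integral_pi_gt0.
case: (ex_maxnP P0 Pb) => m /asboolP[u cu] mmax.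
exists m, u; split=> //; case: cu => u1 uc.
apply: cover_sin_integral => //; first by lra.
move=> x x1; apply: contrapT => nox.
have ux i : dot (u i) x <= cos a.
  by rewrite leNgt; apply/negP => h; apply: nox; exists i.
pose v (i : 'I_m.+1) := if unlift ord_max i is Some j then u j else x.
suff : P m.+1 by move/mmax; rewrite ltnn.
apply/asboolP; exists v; split=> [i|i j]; rewrite /v.
  by case: unliftP.
case: unliftP => [i' ->|->]; case: unliftP => [j' ->|->] //.
- by rewrite (inj_eq lift_inj); exact: uc.
- by rewrite dotC.
- by rewrite eqxx.
Qed.

(** * From spherical codes to kissing configurations *)

Lemma acos_lt_cos (x r : R) : -1 <= x <= 1 -> 0 <= r <= pi -> acos x < r -> cos r < x.
Proof.
move=> x1 rpi xr; rewrite -(@acosK _ x) ?in_itv//.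
by rewrite ltr_cos ?in_itv//= ?acos_ge0 ?acos_lepi.
Qed.

(** For a common interior point z, removing from x + y its component along z gives (<x,z> + <y,z>)^2
    <= 2 + 2<x,y> <= 4 cos(r)^2, whereas both products exceed cos r >= 0. *)
Lemma angular_disjoint n (r : R) (x y : 'rV[R]_n.+1) : 0 <= r <= pi / 2 ->
  dot x x = 1 -> dot y y = 1 -> dot x y <= cos (r *+ 2) ->
  disjoint_interiors (@unit_sphere R n) (@angular_dist R n) r x y.
Proof.
move=> rpi x1 y1; rewrite cos_mulr2n => xy; have pi0 := pi_gt0 R.
apply/seteqP; split=> // z [[/= z1 xz] [_ yz]].
have r0pi : 0 <= r <= pi by lra.
have cr : 0 <= cos r by apply: cos_ge0_pihalf; lra.
have {}xz := acos_lt_cos (dot_unit_bounded x1 z1) r0pi xz.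
have {}yz := acos_lt_cos (dot_unit_bounded y1 z1) r0pi yz.
have := dot_ge0 (x + y - (dot x z + dot y z) *: z).
rewrite !(dotDl, dotDr, dotNl, dotNr, dotZl, dotZr) x1 y1 z1.
rewrite (dotC y x) (dotC z x) (dotC z y).
move: (dot x z) (dot y z) (dot x y) xz yz xy => p k d xz yz xy.
rewrite -mulr_natr in xy; nra.
Qed.

Lemma kissing_number_ge T (X : set T) (d : T -> T -> R) r m c0 (c : 'I_m -> T) :
  kissing_configuration X d r c0 c -> (m%:R%:E <= kissing_number X d r)%E.
Proof.
by move=> h; apply: ereal_sup_ubound; exists m => //; exists c0, c.
Qed.

(** For a unit vector u, geodesic polar coordinates on S^n; the pole is [polar 0 0], since sin 0
    erases the direction. *)
Definition polar n (t : R) (u : 'rV[R]_n) : 'rV[R]_n.+1 :=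
  row_mx (cos t)%:M (sin t *: u).

Lemma dot_polar n s t (u v : 'rV[R]_n) :
  dot (polar s u) (polar t v) = cos s * cos t + sin s * sin t * dot u v.
Proof. by rewrite /polar [LHS]dot_row_mx dotZl dotZr mulrA. Qed.

(** Centres are placed at distance 2r from the pole. By the spherical law of cosines they are 2r
    apart when <u_i, u_j> <= cos 2r / (1 + cos 2r), which is 1 - sec(r)^2 / 2. *)
Lemma spherical_kissing n m (r : R) (u : 'I_m -> 'rV[R]_n) :
  0 <= r <= pi / 3 -> spherical_code (1 - sec r ^+ 2 / 2) u ->
  (m%:R%:E <= kissing_number (@unit_sphere R n) (@angular_dist R n) r)%E.
Proof.
move=> rpi [u1 uc]; have pi0 := pi_gt0 R.
have c0 : 0 < cos r by apply: cos_gt0_pihalf; lra.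
apply: (@kissing_number_ge _ _ _ _ _ (polar 0 0) (fun i => polar (r *+ 2) (u i))).
have polar1 t i : dot (polar t (u i)) (polar t (u i)) = 1.
  by rewrite dot_polar u1 mulr1 -!expr2 cos2Dsin2.
have north t (v : 'rV[R]_n) : dot (polar 0 0) (polar t v) = cos t.
  by rewrite dot_polar cos0 sin0 !mul0r addr0 mul1r.
have north1 : dot (polar 0 0 : 'rV[R]_n.+1) (polar 0 0) = 1 by rewrite north cos0.
split=> // [i|i|i j ij].
- exact: polar1.
- split.
    (* The contact point is the midpoint of the two centres. *)
    exists (polar r (u i)); split; split; try exact: polar1.
      by rewrite /angular_dist north cosK// in_itv/=; lra.
    rewrite /angular_dist dot_polar u1 mulr1 -cosB mulr2n addrK cosK// in_itv/=; lra.
  by apply: angular_disjoint => //; [lra|rewrite north].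
- apply: angular_disjoint; [lra|exact: polar1|exact: polar1|].
  rewrite dot_polar; have := uc i j ij; rewrite /sec exprVn => d.
  have s2 := sin2cos2 r.
  rewrite !cos_mulr2n sin_mulr2n !mulr2n.
  have C0 : 0 < cos r ^+ 2 by rewrite exprn_gt0.
  have S0 : 0 <= sin r ^+ 2 by exact: sqr_ge0.
  have -> : (cos r * sin r + cos r * sin r) * (cos r * sin r + cos r * sin r) =
    4 * cos r ^+ 2 * sin r ^+ 2 by ring.
  apply: (@le_trans _ _
    ((cos r ^+ 2 + cos r ^+ 2 - 1) * (cos r ^+ 2 + cos r ^+ 2 - 1) +
      4 * cos r ^+ 2 * sin r ^+ 2 * (1 - (cos r ^+ 2)^-1 / 2))).
    by rewrite lerD2l ler_wpM2l// mulr_ge0// mulr_ge0// ltW.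
  rewrite s2 le_eqVlt; apply/orP; left; apply/eqP.
  by move: (cos r ^+ 2) C0 => C C0; field; rewrite gt_eqF.
Qed.

Lemma euclidean_kissing n m (u : 'I_m -> 'rV[R]_n) :
  spherical_code (1 / 2) u -> (m%:R%:E <= euclidean_kissing_number R n)%E.
Proof.
move=> [u1 uc].
apply: (@kissing_number_ge _ _ _ _ _ 0 (fun i => 2 *: u i)).
have disj (x y : 'rV[R]_n) : 4 <= dot (x - y) (x - y) ->
    disjoint_interiors [set: 'rV[R]_n] (@euclidean_dist R n) 1 x y.
  move=> xy; apply/seteqP; split=> // z [[_ xz] [_ yz]].
  have lt1 (w : 'rV[R]_n) : Num.sqrt (dot w w) < 1 -> dot w w < 1.
    by rewrite -{1}sqrtr1 ltr_sqrt.
  have {}xz := lt1 _ xz; have {}yz := lt1 _ yz.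
  (* Parallelogram law: |x - y|^2 <= 2|x - z|^2 + 2|y - z|^2 < 4. *)
  have := dot_ge0 (x - z + (y - z)).
  move: xz yz xy; rewrite !(dotDl, dotDr, dotNl, dotNr).
  rewrite (dotC y x) (dotC z x) (dotC z y); lra.
split=> // [i|i j ij].
- split.
    exists (u i); split; split=> //; rewrite /euclidean_dist.
      by rewrite sub0r dotNl dotNr opprK u1 sqrtr1.
    by rewrite scaler_nat mulr2n addrK u1 sqrtr1.
  apply: disj; rewrite sub0r dotNl dotNr dotZl dotZr u1; lra.
- apply: disj; have := uc i j ij.
  by rewrite !(dotDl, dotDr, dotNl, dotNr, dotZl, dotZr) !u1 (dotC (u j)); lra.
Qed.

Lemma kappaS_ge n m (r : R) (u : 'I_m -> 'rV[R]_n) :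
  0 <= r <= pi / 3 -> spherical_code (1 - sec r ^+ 2 / 2) u ->
  (m%:R%:E <= kappaS n r)%E.
Proof.
move=> rpi cu; rewrite /kappaS; case: eqP => [r0|_]; last first.
  exact: spherical_kissing rpi cu.
apply: (@euclidean_kissing _ _ u); move: cu; rewrite r0 /sec cos0 invr1 expr1n.
by have -> : 1 - 1 / 2 = 1 / 2 :> R by field.
Qed.

(** * The angle between directions *)

Lemma cos_pi3 : cos (pi / 3) = 1 / 2 :> R.
Proof.
have pi0 := pi_gt0 R.
have : cos (pi / 3 *+ 2 + pi / 3) = -1 :> R.
  by rewrite -cospi; congr cos; rewrite -mulr_natr; field.
rewrite cosD cos_mulr2n sin_mulr2n [cos _ ^+ 2 *+ 2]mulr2n [_ * sin _ *+ 2]mulr2n.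
have -> : (cos (pi / 3) * sin (pi / 3) + cos (pi / 3) * sin (pi / 3)) *
    sin (pi / 3) =
  2 * cos (pi / 3) * sin (pi / 3) ^+ 2 :> R by ring.
rewrite sin2cos2; have : 0 <= cos (pi / 3 : R) by apply: cos_ge0_pihalf; lra.
(* The triple angle formula 4c^3 - 3c = -1, factored. *)
move: (cos _) => c c0 h; have : (c + 1) * (2 * c - 1) ^+ 2 = 0 by lra.
by move/eqP; rewrite mulf_eq0 sqrf_eq0 => /orP[] /eqP; lra.
Qed.

Lemma cos_pi4_sqr : cos (pi / 4) ^+ 2 = 1 / 2 :> R.
Proof.
have : cos (pi / 4 *+ 2) = 0 :> R.
  by rewrite -cos_pihalf; congr cos; rewrite -mulr_natr; field.
by rewrite cos_mulr2n -mulr_natr; lra.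
Qed.

Lemma ler_cos (x y : R) : 0 <= x -> x <= y -> y <= pi -> cos y <= cos x.
Proof. by move=> x0 xy ypi; rewrite leNgt ltr_cos ?in_itv/=; lra. Qed.

(** The bound r <= pi / 3 gives sec(r)^2 <= 4, so the arccosine is defined; a passes pi / 2 when
    sec(r)^2 = 2, at r = pi / 4. Hence the two cases of the theorem. *)
Lemma kissing_angle (r : R) : 0 <= r <= pi / 3 -> exists a : R,
  [/\ 0 < a <= pi, cos a = 1 - sec r ^+ 2 / 2,
      sin a ^+ 2 = sec r ^+ 2 - sec r ^+ 4 / 4,
      r <= pi / 4 -> a <= pi / 2 & pi / 4 <= r -> pi / 2 <= a].
Proof.
move=> rpi; have pi0 := pi_gt0 R.
have c1 := cos_le1 r.
have c2 : 1 / 2 <= cos r by rewrite -cos_pi3; apply: ler_cos; lra.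
have c0 : 0 < cos r by lra.
have s1 : 1 <= sec r <= 2.
  rewrite /sec invf_ge1// c1/= -[X in _ <= X]invrK lef_pV2 ?posrE//; lra.
have s12 : 1 <= sec r ^+ 2 <= 4.
  have -> : 4 = 2 ^+ 2 :> R by rewrite expr2 -natrM.
  by rewrite exprn_ege1 ?lerXn2r ?nnegrE; lra.
have s0 : 0 <= sec r ^+ 2 by exact: sqr_ge0.
have x1 : -1 <= 1 - sec r ^+ 2 / 2 <= 1 by lra.
have x1' : -1 <= 1 - sec r ^+ 2 / 2 < 1 by lra.
have ca : cos (acos (1 - sec r ^+ 2 / 2)) = 1 - sec r ^+ 2 / 2.
  by rewrite acosK// in_itv.
have a0 := acos_gt0 x1'; have api := acos_lepi x1.
exists (acos (1 - sec r ^+ 2 / 2)); move: (acos _) ca a0 api => a ca a0 api.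
have E : sec r ^+ 2 * cos r ^+ 2 = 1 by rewrite -exprMn /sec mulVf ?expr1n ?gt_eqF.
split=> //.
- by rewrite a0.
- by rewrite sin2cos2 ca; field.
- move=> r4; have C : 1 / 2 <= cos r ^+ 2.
    rewrite -cos_pi4_sqr ler_sqr ?nnegrE; last exact: ltW.
      by apply: ler_cos; lra.
    by apply: cos_ge0_pihalf; lra.
  rewrite leNgt -ltr_cos ?in_itv/=; [|lra|lra].
  by rewrite cos_pihalf ca -leNgt; have := ler_wpM2l s0 C; rewrite E; lra.
- move=> r4; have C : cos r ^+ 2 <= 1 / 2.
    rewrite -cos_pi4_sqr ler_sqr ?nnegrE; [|exact: ltW|].
      by apply: ler_cos; lra.
    by apply: cos_ge0_pihalf; lra.
  rewrite leNgt -ltr_cos ?in_itv/=; [|lra|lra].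
  by rewrite cos_pihalf ca -leNgt; have := ler_wpM2l s0 C; rewrite E; lra.
Qed.

End Kissing.

Theorem theorem3p2 (R : realType) (n : nat) (r : R)
    (hn : (2 <= n)%N) (hr : 0 <= r) :
  let B := beta ((n%:R - 1) / 2) (1 / 2) : R in
  let Br := inc_beta (sec r ^+ 2 - sec r ^+ 4 / 4) ((n%:R - 1) / 2) (1 / 2) in
  (0 <= r <= pi / 4 -> ((2 * B / Br)%:E <= kappaS n r)%E) /\
  (pi / 4 <= r <= pi / 3 -> ((2 * B / (2 * B - Br))%:E <= kappaS n r)%E).
Proof.
move: n hn => [//|[//|q]] _ B Br; have pi0 := pi_gt0 R.
(* The complete beta value is twice the hemisphere integral, hence by reflection the whole one. *)
have EB : B = sin_integral q pi.
  have -> : B = inc_beta (sin (pi / 2) ^+ 2) ((q.+2%:R - 1) / 2) (1 / 2).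
    by rewrite sin_pihalf expr1n.
  rewrite inc_beta_sin2; last by lra.
  have : sin_integral q (pi - pi / 2) =
      sin_integral q pi - sin_integral q (pi / 2) :> R.
    by apply: sin_integral_sym; lra.
  have -> : pi - pi / 2 = pi / 2 :> R by field.
  lra.
(* Both cases are the same bound S q pi / S q a; only the expression of S q a through [Br]
   differs. *)
suff main : r <= pi / 3 ->
    exists a : R, [/\ 0 < sin_integral q a,
      ((sin_integral q pi / sin_integral q a)%:E <= kappaS q.+2 r)%E,
      r <= pi / 4 -> Br = 2 * sin_integral q a &
      pi / 4 <= r -> Br = 2 * sin_integral q pi - 2 * sin_integral q a].
  rewrite EB; split=> /andP[h1 h2].
    have [|a [a0 ka Ba _]] := main; first by lra.
    rewrite Ba// -mulf_div divff ?mul1r//; lra.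
  have [|a [a0 ka _ Ba]] := main; first by lra.
  have -> : 2 * sin_integral q pi - Br = 2 * sin_integral q a by rewrite Ba//; lra.
  by rewrite -mulf_div divff ?mul1r//; lra.
move=> r3; have r03 : 0 <= r <= pi / 3 by rewrite hr.
have [a [a0pi ca sa a4 a4']] := kissing_angle r03.
have [m [u [cu Sm]]] := large_spherical_code q a0pi.
have Sa := sin_integral_gt0 q a0pi; rewrite ca in cu.
exists a; split=> //.
- by apply: le_trans (kappaS_ge r03 cu); rewrite lee_fin ler_pdivrMr.
- by move=> /a4 ha; rewrite /Br -sa inc_beta_sin2//; lra.
(* For a obtuse, [Br] measures the complementary cap of radius pi - a, which has the same sine. *)
- move=> /a4' ha; rewrite -mulrBr -sin_integral_sym; last by lra.
  by rewrite -inc_beta_sin2 ?sinB ?sinpi ?cospi /Br -?sa; [congr inc_beta; ring|lra].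
Qed.
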